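(* Let $\rho$ be the unique root in $(0,1)$ of $X^3-5X^2+2X+1$ and let $\sigma=\dfrac{1-\rho}{\rho^6}$ (which lies in $(0,1)$). Then $$31\,L(\rho)+L(\sigma)=4\pi^2.$$
   Context: $L(z)=\operatorname{Li}_2(z)+\tfrac12\log z\,\log(1-z)$ for $0<z<1$ is the (unshifted) Rogers dilogarithm, where $\operatorname{Li}_2(z)=\sum_{n\ge1}z^n/n^2$. *)

(* Defs.v *)
From Stdlib Require Import Reals.
From Coquelicot Require Import Coquelicot.
Open Scope R_scope.

(* Sum over n >= 1 of z^n / n^2, reindexed by n = k + 1.  Coquelicot's [Series]
   is total; the series converges for |z| <= 1, which covers 0 < z < 1. *)
Definition Li2 (z : R) : R := Series (fun k : nat => z ^ S k / INR (S k) ^ 2).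

(* Unshifted Rogers dilogarithm; only meaningful for 0 < z < 1, since Stdlib's
   [ln] takes a junk value outside the positive reals. *)
Definition rogersL (z : R) : R := Li2 z + 1 / 2 * ln z * ln (1 - z).

Definition is_rho (x : R) : Prop :=
  0 < x < 1 /\ x ^ 3 - 5 * x ^ 2 + 2 * x + 1 = 0.

Definition sigma_of (rho : R) : R := (1 - rho) / rho ^ 6.

(* Main.v *)
(* In the form [z_(i-1) * z_(i+1) = 1 - z_i] (indices mod 5), the five-term
   relation reads [sum_i rogersL z_i = PI ^ 2 / 2].  It and the reflection formula
   hold because in each the derivative vanishes and the limit at 0 is known; for
   the reflection formula that limit is [Li2 1 = PI ^ 2 / 6], by Abel's theorem and
   the Basel sum.

   The Basel sum comes from [1 / sin^2 x + 1 / cos^2 x = 4 / sin^2 (2 x)]: iterated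
   from [PI / 4], it evaluates the sum of [1 / sin^2] at the odd multiples of
   [PI / (4 N)] below [PI / 2] as [2 * N ^ 2] for N a power of 2, while
   [1 / x^2 <= 1 / sin^2 x <= 1 + 1 / x^2].

   The cubic field Q(rho) is totally real, so a combination of dilogarithms in the
   kernel of [x |-> x /\ (1 - x)] is expected to be a rational combination of
   five-term relations, up to a multiple of [PI ^ 2].  Eighteen such relations
   among elements of Q(rho), each verified modulo the minimal polynomial of rho,
   and the reflection formula give the result. *)

Require Import Defs.
From Stdlib Require Import Reals Lra Lia.
From Coquelicot Require Import Coquelicot.
Open Scope R_scope.

(** * Power series with coefficients 1/n^p *)

Lemma CV_radius_ge_1 (a : nat -> R) :
  (forall n, Rabs (a n) <= 1) -> Rbar_le 1 (CV_radius a).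
Proof.
  intros Ha. apply (proj1 (CV_radius_bounded a)).
  exists 1. intros n. rewrite pow1, Rmult_1_r. apply Ha.
Qed.

Lemma is_derive_PSeries_unit (a : nat -> R) (x : R) :
  (forall n, Rabs (a n) <= 1) -> 0 < x < 1 ->
  is_derive (PSeries a) x (PSeries (PS_derive a) x).
Proof.
  intros Ha Hx. apply is_derive_PSeries.
  apply Rbar_lt_le_trans with 1; [|apply CV_radius_ge_1, Ha].
  simpl. rewrite Rabs_pos_eq; lra.
Qed.

(** The sequence [PS_incr_1 (fun k => / INR (S k) ^ p)], with value 0 at index 0, holds the
    coefficients of Li_p: [p = 1] gives -ln (1 - z) and [p = 2] gives [Li2]. *)
Lemma Rabs_incr_inv_pow (p n : nat) :
  Rabs (PS_incr_1 (fun k => / INR (S k) ^ p) n) <= 1.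
Proof.
  destruct n as [|n].
  - change (Rabs 0 <= 1). rewrite Rabs_R0. lra.
  - change (Rabs (/ INR (S n) ^ p) <= 1).
    assert (H : 1 <= INR (S n)) by (apply (le_INR 1); lia).
    assert (1 <= INR (S n) ^ p) by (apply pow_R1_Rle, H).
    rewrite Rabs_pos_eq.
    + apply Rle_trans with (/ 1); [apply Rinv_le_contravar|]; lra.
    + left. apply Rinv_0_lt_compat. lra.
Qed.

Lemma PSeries_ones (z : R) : 0 < z < 1 -> PSeries (fun _ => 1) z = / (1 - z).
Proof.
  intros Hz. rewrite <- (Series_geom z) by (rewrite Rabs_pos_eq; lra).
  apply Series_ext. intros n. apply Rmult_1_l.
Qed.

(** On the level of coefficients this is Li_{p+1}'(z) = Li_p(z) / z. *)
Lemma PS_derive_incr_inv_pow (p n : nat) :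
  PS_derive (PS_incr_1 (fun k => / INR (S k) ^ S p)) n = / INR (S n) ^ p.
Proof.
  change (INR (S n) * / INR (S n) ^ S p = / INR (S n) ^ p). rewrite <- tech_pow_Rmult.
  assert (INR (S n) <> 0) by (apply not_0_INR; lia).
  field. split; [apply pow_nonzero|]; assumption.
Qed.

(** * Functions on (0,1) with zero derivative *)

Lemma derive_zero_constant_unit (f : R -> R) :
  (forall t, 0 < t < 1 -> is_derive f t 0) ->
  forall s t, 0 < s < 1 -> 0 < t < 1 -> f s = f t.
Proof.
  intros Hf.
  assert (K : forall s t, 0 < s -> s < t -> t < 1 -> f s = f t).
  { intros s t Hs Hst Ht. apply eq_is_derive; [|exact Hst].
    intros u Hu. apply Hf. lra. }
  intros s t Hs Ht. destruct (Rtotal_order s t) as [H|[H|H]].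
  - apply K; lra.
  - now rewrite H.
  - symmetry. apply K; lra.
Qed.

(** A fixed sequence in (0, 1/2] tending to 0. One-sided limits at 0, and at 1 along [1 - small n],
    are taken along it. *)
Definition small (n : nat) : R := / (INR n + 2).

Lemma small_bounds (n : nat) : 0 < small n <= 1 / 2.
Proof.
  unfold small. pose proof (pos_INR n). split.
  - apply Rinv_0_lt_compat. lra.
  - unfold Rdiv. rewrite Rmult_1_l. apply Rinv_le_contravar; lra.
Qed.

Lemma small_lim : is_lim_seq small 0.
Proof.
  unfold small. replace (Finite 0) with (Rbar_inv p_infty) by reflexivity.
  apply is_lim_seq_inv; [|discriminate].
  apply is_lim_seq_ext with (fun n => INR (n + 2)).
  - intros n. rewrite plus_INR. reflexivity.
  - apply is_lim_seq_incr_n with (u := INR). apply is_lim_seq_INR.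
Qed.

(** Since [f] is constant on (0,1), its values along [small] all equal [f t]. The logarithm series,
    the five-term relation and the reflection formula are obtained this way. *)
Lemma derive_zero_eq_limit (f : R -> R) (l : R) :
  (forall t, 0 < t < 1 -> is_derive f t 0) ->
  is_lim_seq (fun n => f (small n)) l ->
  forall t, 0 < t < 1 -> f t = l.
Proof.
  intros Hf Hl t Ht.
  assert (H : is_lim_seq (fun _ => f t) l).
  { apply is_lim_seq_ext with (2 := Hl). intros n.
    pose proof (small_bounds n).
    apply derive_zero_constant_unit; [exact Hf|lra|exact Ht]. }
  apply is_lim_seq_unique in H. rewrite Lim_seq_const in H. congruence.
Qed.

Lemma is_lim_seq_one_minus_small : is_lim_seq (fun n => 1 - small n) 1.
Proof.
  replace (Finite 1) with (Finite (1 - 0)) by (f_equal; ring).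
  apply is_lim_seq_minus' ; [apply is_lim_seq_const|apply small_lim].
Qed.

(** * Derivatives of the dilogarithm and of the Rogers dilogarithm *)

Lemma PSeries_log (z : R) :
  0 < z < 1 -> z * PSeries (fun k => / INR (S k)) z = - ln (1 - z).
Proof.
  intros Hz.
  assert (E : forall t, t * PSeries (fun k => / INR (S k)) t
    = PSeries (PS_incr_1 (fun k => / INR (S k) ^ 1)) t).
  { intros t. rewrite PSeries_incr_1. f_equal. apply PSeries_ext.
    intros n. now rewrite pow_1. }
  rewrite E.
  set (g := PSeries (PS_incr_1 (fun k => / INR (S k) ^ 1))).
  (* The derivatives 1/(1-t) and -1/(1-t) of the two summands cancel, and both summands vanish at
     0. *)
  enough (H : g z + ln (1 - z) = 0) by lra.
  apply (derive_zero_eq_limit (fun t => g t + ln (1 - t)) 0); [| |exact Hz].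
  - intros t Ht.
    assert (D : is_derive g t (/ (1 - t))).
    { rewrite <- PSeries_ones by exact Ht.
      replace (PSeries (fun _ => 1) t)
        with (PSeries (PS_derive (PS_incr_1 (fun k => / INR (S k) ^ 1))) t).
      - apply is_derive_PSeries_unit; [apply Rabs_incr_inv_pow|exact Ht].
      - apply PSeries_ext. intros n. rewrite PS_derive_incr_inv_pow.
        simpl. apply Rinv_1. }
    replace 0 with (plus (/ (1 - t)) (- / (1 - t))) by (unfold plus; simpl; ring).
    apply (is_derive_plus g (fun t => ln (1 - t))); [exact D|].
    auto_derive; [lra|field; lra].
  - replace 0 with (g 0 + ln 1).
    2:{ rewrite ln_1. unfold g. rewrite PSeries_0. simpl. change (0 + 0 = 0). ring. }
    apply is_lim_seq_plus'.
    + apply is_lim_seq_continuous; [|apply small_lim].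
      apply PSeries_continuity. rewrite Rabs_R0.
      apply Rbar_lt_le_trans with 1; [simpl; lra|].
      apply CV_radius_ge_1, Rabs_incr_inv_pow.
    + apply is_lim_seq_continuous; [|apply is_lim_seq_one_minus_small].
      apply derivable_continuous_pt. exists (/ 1). apply derivable_pt_lim_ln. lra.
Qed.

Lemma Li2_PSeries (z : R) :
  Li2 z = PSeries (PS_incr_1 (fun k => / INR (S k) ^ 2)) z.
Proof.
  rewrite PSeries_incr_1. unfold Li2, PSeries. rewrite <- Series_scal_l.
  apply Series_ext. intros n. rewrite <- tech_pow_Rmult. unfold Rdiv. ring.
Qed.

Lemma is_derive_Li2 (z : R) : 0 < z < 1 -> is_derive Li2 z (- ln (1 - z) / z).
Proof.
  intros Hz. apply is_derive_ext with (1 := fun t => eq_sym (Li2_PSeries t)).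
  replace (- ln (1 - z) / z)
    with (PSeries (PS_derive (PS_incr_1 (fun k => / INR (S k) ^ 2))) z).
  - apply is_derive_PSeries_unit; [apply Rabs_incr_inv_pow|exact Hz].
  - rewrite <- PSeries_log by exact Hz.
    rewrite (PSeries_ext _ (fun k => / INR (S k))); [field; lra|].
    intros n. rewrite PS_derive_incr_inv_pow. now rewrite pow_1.
Qed.

Lemma is_derive_rogersL (z : R) : 0 < z < 1 ->
  is_derive rogersL z (- (ln (1 - z) / z + ln z / (1 - z)) / 2).
Proof.
  intros Hz. unfold rogersL.
  replace (- (ln (1 - z) / z + ln z / (1 - z)) / 2)
    with (plus (- ln (1 - z) / z) ((ln (1 - z) / z - ln z / (1 - z)) / 2))
    by (unfold plus; simpl; field; lra).
  apply (is_derive_plus Li2 (fun z => 1 / 2 * ln z * ln (1 - z))).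
  - apply is_derive_Li2, Hz.
  - auto_derive; [lra|unfold Rminus; field; lra].
Qed.

Lemma is_derive_rogersL_comp (f : R -> R) (x df : R) :
  is_derive f x df -> 0 < f x < 1 ->
  is_derive (fun t => rogersL (f t)) x
    (- (ln (1 - f x) / f x + ln (f x) / (1 - f x)) / 2 * df).
Proof.
  intros Hf Hx. rewrite Rmult_comm.
  apply (is_derive_comp rogersL f); [apply is_derive_rogersL, Hx|exact Hf].
Qed.

(** * The limit of the Rogers dilogarithm at 0 *)

Lemma ln_sqrt_bound (z : R) : 0 < z < 1 -> - ln z <= 2 / sqrt z.
Proof.
  intros Hz. pose proof (sqrt_lt_R0 z ltac:(lra)) as Hs.
  (* Passing to the square root before using ln y <= y gives growth of order z^(-1/2) only, which
     the factor ln (1 - z) = O(z) outweighs. *)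
  assert (E : ln z = 2 * ln (sqrt z)).
  { rewrite <- (sqrt_sqrt z) at 1 by lra. rewrite ln_mult by assumption. ring. }
  assert (H : ln (/ sqrt z) <= / sqrt z).
  { pose proof (Rinv_0_lt_compat _ Hs) as Hi.
    pose proof (exp_ineq1_le (ln (/ sqrt z))) as B.
    rewrite exp_ln in B by exact Hi. lra. }
  rewrite ln_Rinv in H by exact Hs. unfold Rdiv. lra.
Qed.

(** Both bounds come from exp u >= 1 + u, at u = ln (1 - z) and at u = -ln (1 - z); the second also
    uses (1 - z)(1 + 2z) >= 1, true for 0 <= z <= 1/2. *)
Lemma ln_one_minus_bound (z : R) : 0 < z <= 1 / 2 -> 0 <= - ln (1 - z) <= 2 * z.
Proof.
  intros Hz. split.
  - pose proof (exp_ineq1_le (ln (1 - z))) as B. rewrite exp_ln in B by lra. lra.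
  - rewrite <- ln_Rinv by lra.
    pose proof (exp_ineq1_le (ln (/ (1 - z)))) as B.
    rewrite exp_ln in B by (apply Rinv_0_lt_compat; lra).
    enough (/ (1 - z) <= 1 + 2 * z) by lra.
    apply Rmult_le_reg_l with (1 - z); [lra|].
    rewrite Rinv_r by lra. nra.
Qed.

Lemma ln_mul_ln_bound (z : R) :
  0 < z <= 1 / 2 -> 0 <= ln z * ln (1 - z) <= 4 * sqrt z.
Proof.
  intros Hz. pose proof (sqrt_lt_R0 z ltac:(lra)) as Hs.
  pose proof (ln_sqrt_bound z ltac:(lra)) as B1.
  pose proof (ln_one_minus_bound z Hz) as [B2 B3].
  assert (B0 : 0 <= - ln z).
  { pose proof (exp_ineq1_le (ln z)) as B. rewrite exp_ln in B by lra. lra. }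
  replace (ln z * ln (1 - z)) with ((- ln z) * (- ln (1 - z))) by ring.
  split; [apply Rmult_le_pos; assumption|].
  apply Rle_trans with (2 / sqrt z * (2 * z)).
  - apply Rmult_le_compat; assumption.
  - right. rewrite <- (sqrt_sqrt z) at 2 by lra. field. lra.
Qed.

Lemma is_lim_seq_ln_mul_ln (u : nat -> R) :
  (forall n, 0 < u n <= 1 / 2) -> is_lim_seq u 0 ->
  is_lim_seq (fun n => ln (u n) * ln (1 - u n)) 0.
Proof.
  intros Hu Hl.
  apply is_lim_seq_le_le with (fun _ => 0) (fun n => 4 * sqrt (u n)).
  - intros n. apply ln_mul_ln_bound, Hu.
  - apply is_lim_seq_const.
  - replace (Finite 0) with (Rbar_mult 4 (sqrt 0)) by (simpl; rewrite sqrt_0; f_equal; ring).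
    apply is_lim_seq_scal_l. apply is_lim_seq_continuous; [|exact Hl].
    apply continuity_pt_sqrt. lra.
Qed.

Lemma Li2_continuity_0 : continuity_pt Li2 0.
Proof.
  apply continuity_pt_ext with (1 := fun t => eq_sym (Li2_PSeries t)).
  apply PSeries_continuity. rewrite Rabs_R0.
  apply Rbar_lt_le_trans with 1; [simpl; lra|].
  apply CV_radius_ge_1, Rabs_incr_inv_pow.
Qed.

Lemma Li2_0 : Li2 0 = 0.
Proof. rewrite Li2_PSeries, PSeries_0. reflexivity. Qed.

Lemma is_lim_seq_rogersL_0 (u : nat -> R) :
  (forall n, 0 < u n <= 1 / 2) -> is_lim_seq u 0 ->
  is_lim_seq (fun n => rogersL (u n)) 0.
Proof.
  intros Hu Hl. unfold rogersL.
  apply is_lim_seq_ext with (fun n => Li2 (u n) + 1 / 2 * (ln (u n) * ln (1 - u n))).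
  - intros n. ring.
  - replace 0 with (Li2 0 + 1 / 2 * 0) by (rewrite Li2_0; ring).
    apply is_lim_seq_plus'.
    + apply is_lim_seq_continuous; [apply Li2_continuity_0|exact Hl].
    + apply (is_lim_seq_scal_l _ _ 0). apply is_lim_seq_ln_mul_ln; assumption.
Qed.

(** * The five-term relation *)

Lemma div_unit (a b : R) : 0 < a < b -> 0 < a / b < 1.
Proof.
  intros Hab. split; [apply Rdiv_lt_0_compat; lra|].
  apply Rmult_lt_reg_r with b; [lra|]. unfold Rdiv.
  rewrite Rmult_assoc, Rinv_l by lra. lra.
Qed.

Lemma mult_unit (x y : R) : 0 < x < 1 -> 0 < y < 1 -> 0 < x * y < 1.
Proof. intros Hx Hy. split; nra. Qed.

Lemma five_term_unit (x y : R) : 0 < x < 1 -> 0 < y < 1 ->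
  0 < x * (1 - y) / (1 - x * y) < 1.
Proof. intros Hx Hy. apply div_unit. split; nra. Qed.

Lemma five_term_derive (y t : R) : 0 < y < 1 -> 0 < t < 1 ->
  is_derive (fun t => rogersL t + rogersL y - rogersL (t * y)
    - rogersL (t * (1 - y) / (1 - t * y)) - rogersL (y * (1 - t) / (1 - t * y)))
    t 0.
Proof.
  intros Hy Ht.
  pose proof (mult_unit t y Ht Hy) as B1.
  pose proof (five_term_unit t y Ht Hy) as B2.
  pose proof (five_term_unit y t Hy Ht) as B3. rewrite (Rmult_comm y t) in B3.
  pose proof (is_derive_rogersL t Ht) as D0.
  assert (D1 : is_derive (fun t => t * y) t y) by (auto_derive; [trivial|ring]).
  apply is_derive_rogersL_comp in D1; [|exact B1].
  assert (D2 : is_derive (fun t => t * (1 - y) / (1 - t * y)) t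
    ((1 - y) / (1 - t * y) ^ 2)) by (auto_derive; [lra|field; lra]).
  apply is_derive_rogersL_comp in D2; [|exact B2].
  assert (D3 : is_derive (fun t => y * (1 - t) / (1 - t * y)) t
    (- y * (1 - y) / (1 - t * y) ^ 2)) by (auto_derive; [lra|field; lra]).
  apply is_derive_rogersL_comp in D3; [|exact B3].
  pose proof (is_derive_minus _ _ _ _ _ (is_derive_minus _ _ _ _ _
    (is_derive_minus _ _ _ _ _ (is_derive_plus _ _ _ _ _ D0
      (is_derive_const (rogersL y) t)) D1) D2) D3) as D.
  match type of D with is_derive _ _ ?d => replace 0 with d; [exact D|] end.
  unfold minus, plus, opp, zero; simpl.
  (* The complements factor like the arguments, so every logarithm splits into those of t, y, 1-t,
     1-y and 1-ty, and a rational identity remains. *)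
  replace (1 - t * (1 - y) / (1 - t * y)) with ((1 - t) / (1 - t * y)) by (field; lra).
  replace (1 - y * (1 - t) / (1 - t * y)) with ((1 - y) / (1 - t * y)) by (field; lra).
  assert (0 < t * (1 - y)) by (apply Rmult_lt_0_compat; lra).
  assert (0 < y * (1 - t)) by (apply Rmult_lt_0_compat; lra).
  rewrite !ln_div, !ln_mult by lra. field. lra.
Qed.

Lemma rogersL_five_term (x y : R) : 0 < x < 1 -> 0 < y < 1 ->
  rogersL x + rogersL y = rogersL (x * y)
    + rogersL (x * (1 - y) / (1 - x * y)) + rogersL (y * (1 - x) / (1 - x * y)).
Proof.
  intros Hx Hy.
  pose (f t := rogersL t + rogersL y - rogersL (t * y)
    - rogersL (t * (1 - y) / (1 - t * y)) - rogersL (y * (1 - t) / (1 - t * y))).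
  enough (f x = 0) by (unfold f in *; lra).
  apply (derive_zero_eq_limit f); [|clear x Hx|exact Hx].
  { intros t Ht. apply five_term_derive; assumption. }
  pose proof small_bounds as S. pose proof small_lim as Sl.
  assert (Cont : forall g, continuity_pt g 0 -> is_lim_seq (fun n => g (small n)) (g 0)).
  { intros g Hg. apply is_lim_seq_continuous; assumption. }
  assert (Ex : forall g, ex_derive g 0 -> continuity_pt g 0).
  { intros g Hg. apply continuity_pt_filterlim.
    apply (ex_derive_continuous (V := R_NormedModule)), Hg. }
  (* As t tends to 0, the last argument tends to y and the other arguments depending on t tend to
     0. *)
  replace (Finite 0) with (Finite (0 + rogersL y - 0 - 0 - rogersL y))
    by (f_equal; ring).
  unfold f.
  repeat apply is_lim_seq_minus'; [apply is_lim_seq_plus'|..].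
  - apply is_lim_seq_rogersL_0; assumption.
  - apply is_lim_seq_const.
  - apply is_lim_seq_rogersL_0.
    + intros n. specialize (S n). split; nra.
    + replace (Finite 0) with (Finite (0 * y)) by (f_equal; ring).
      apply (Cont (fun t => t * y)), Ex. auto_derive. trivial.
  - apply is_lim_seq_rogersL_0.
    + intros n. specialize (S n).
      pose proof (five_term_unit (small n) y ltac:(lra) Hy) as B.
      split; [apply B|].
      apply Rmult_le_reg_r with (1 - small n * y); [nra|].
      unfold Rdiv. rewrite Rmult_assoc, Rinv_l by nra. nra.
    + replace (Finite 0) with (Finite (0 * (1 - y) / (1 - 0 * y)))
        by (f_equal; field; lra).
      apply (Cont (fun t => t * (1 - y) / (1 - t * y))), Ex. auto_derive. lra.
  - apply is_lim_seq_continuous.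
    + apply continuity_pt_filterlim, (ex_derive_continuous (V := R_NormedModule)).
      eexists. apply is_derive_rogersL, Hy.
    + replace (Finite y) with (Finite (y * (1 - 0) / (1 - 0 * y)))
        by (f_equal; field; lra).
      apply (Cont (fun t => y * (1 - t) / (1 - t * y))), Ex. auto_derive. lra.
Qed.

(** * The Basel sum and the reflection formula *)

(** The function sin t - t cos t vanishes at 0 and has derivative t sin t, which is positive
    here. *)
Lemma mul_cos_le_sin (x : R) : 0 < x < PI / 2 -> x * cos x <= sin x.
Proof.
  intros Hx.
  destruct (MVT_cor2 (fun t => sin t - t * cos t) (fun t => t * sin t) 0 x)
    as [c [Hc Bc]]; [lra| |].
  - intros c _. apply is_derive_Reals. auto_derive; [trivial|ring].
  - rewrite sin_0 in Hc.
    assert (0 < sin c) by (apply sin_gt_0; lra).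
    assert (0 < c * sin c) by (apply Rmult_lt_0_compat; lra).
    assert (0 < c * sin c * (x - 0)) by (apply Rmult_lt_0_compat; lra).
    lra.
Qed.

(** The lower bound is sin x <= x. The upper one is 1/sin^2 x = 1 + cot^2 x with cot x <= 1/x,
    cleared of denominators. *)
Lemma inv_sin_sqr_bounds (x : R) : 0 < x < PI / 2 ->
  / x ^ 2 <= / sin x ^ 2 <= 1 + / x ^ 2.
Proof.
  intros Hx.
  assert (Hs : 0 < sin x) by (apply sin_gt_0; lra).
  assert (Hc : 0 < cos x) by (apply cos_gt_0; lra).
  pose proof (sin_lt_x x ltac:(lra)) as Hsx.
  pose proof (mul_cos_le_sin x Hx) as Hxs.
  pose proof (sin2_cos2 x) as P. unfold Rsqr in P.
  split.
  - apply Rinv_le_contravar; [apply pow_lt, Hs|]. apply pow_incr. lra.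
  - assert (Q : (x * cos x) ^ 2 <= sin x ^ 2) by (apply pow_incr; nra).
    apply Rmult_le_reg_l with (x ^ 2 * sin x ^ 2); [apply Rmult_lt_0_compat; apply pow_lt; lra|].
    replace (x ^ 2 * sin x ^ 2 * / sin x ^ 2) with (x ^ 2) by (field; lra).
    replace (x ^ 2 * sin x ^ 2 * (1 + / x ^ 2)) with (x ^ 2 * sin x ^ 2 + sin x ^ 2)
      by (field; lra).
    replace (x ^ 2) with (x ^ 2 * (sin x * sin x + cos x * cos x)) at 1
      by (rewrite P; ring).
    lra.
Qed.

Lemma inv_sin_sqr_double (x : R) : 0 < x < PI / 2 ->
  / sin x ^ 2 + / sin (PI / 2 - x) ^ 2 = 4 * / sin (2 * x) ^ 2.
Proof.
  intros Hx. rewrite sin_shift, sin_2a.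
  assert (Hs : 0 < sin x) by (apply sin_gt_0; lra).
  assert (Hc : 0 < cos x) by (apply cos_gt_0; lra).
  pose proof (sin2_cos2 x) as P. unfold Rsqr in P.
  replace (4 * / (2 * sin x * cos x) ^ 2)
    with ((sin x * sin x + cos x * cos x) / (sin x ^ 2 * cos x ^ 2))
    by (rewrite P; field; lra).
  field. lra.
Qed.

Fixpoint rsum (f : nat -> R) (n : nat) : R :=
  match n with O => 0 | S m => rsum f m + f m end.

Lemma rsum_ext (f g : nat -> R) (n : nat) :
  (forall k, (k < n)%nat -> f k = g k) -> rsum f n = rsum g n.
Proof.
  induction n as [|n IH]; intros H; simpl; [reflexivity|].
  rewrite IH, H by (intros; try apply H; lia). reflexivity.
Qed.

Lemma rsum_le (f g : nat -> R) (n : nat) :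
  (forall k, (k < n)%nat -> f k <= g k) -> rsum f n <= rsum g n.
Proof.
  induction n as [|n IH]; intros H; simpl; [lra|].
  apply Rplus_le_compat; [apply IH; intros; apply H; lia|apply H; lia].
Qed.

Lemma rsum_plus (f g : nat -> R) (n : nat) :
  rsum (fun k => f k + g k) n = rsum f n + rsum g n.
Proof. induction n as [|n IH]; simpl; lra. Qed.

Lemma rsum_scal (c : R) (f : nat -> R) (n : nat) :
  rsum (fun k => c * f k) n = c * rsum f n.
Proof. induction n as [|n IH]; simpl; lra. Qed.

Lemma rsum_one (n : nat) : rsum (fun _ => 1) n = INR n.
Proof.
  induction n as [|n IH]; [reflexivity|]. rewrite S_INR. simpl. lra.
Qed.

Lemma rsum_app (f : nat -> R) (m n : nat) :
  rsum f (m + n) = rsum f m + rsum (fun k => f (m + k)%nat) n.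
Proof.
  induction n as [|n IH]; simpl; [rewrite Nat.add_0_r; lra|].
  rewrite Nat.add_succ_r. simpl. lra.
Qed.

Lemma rsum_first (f : nat -> R) (n : nat) :
  rsum f (S n) = f O + rsum (fun k => f (S k)) n.
Proof.
  transitivity (rsum f (1 + n)); [reflexivity|]. rewrite rsum_app. simpl. lra.
Qed.

Lemma rsum_rev (f : nat -> R) (n : nat) :
  rsum f n = rsum (fun k => f (n - 1 - k)%nat) n.
Proof.
  revert f. induction n as [|n IH]; intros f; [reflexivity|].
  rewrite rsum_first, IH. simpl. rewrite Nat.sub_0_r, Nat.sub_diag, Rplus_comm.
  f_equal. apply rsum_ext. intros k Hk. f_equal. lia.
Qed.

Lemma rsum_incr (f : nat -> R) (m n : nat) :
  (forall k, 0 <= f k) -> (m <= n)%nat -> rsum f m <= rsum f n.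
Proof.
  intros Hf. induction 1 as [|n _ IH]; simpl; [lra|]. specialize (Hf n). lra.
Qed.

Definition odd_angle (N k : nat) : R := INR (2 * k + 1) * PI / (4 * INR N).

Lemma odd_angle_bounds (N k : nat) : (k < N)%nat -> 0 < odd_angle N k < PI / 2.
Proof.
  intros Hk. pose proof PI_RGT_0.
  assert (H1 : 0 < INR (2 * k + 1)) by (apply lt_0_INR; lia).
  assert (H2 : INR (2 * k + 1) < INR (2 * N)) by (apply lt_INR; lia).
  rewrite (mult_INR 2 N) in H2. change (INR 2) with 2 in H2.
  unfold odd_angle. split.
  - apply Rdiv_lt_0_compat; [apply Rmult_lt_0_compat|]; lra.
  - apply Rmult_lt_reg_r with (4 * INR N); [lra|].
    replace (INR (2 * k + 1) * PI / (4 * INR N) * (4 * INR N))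
      with (INR (2 * k + 1) * PI) by (field; lra).
    nra.
Qed.

(** The upper half of the angles of level 2N, read backwards, consists of the complements pi/2 - x
    of the lower half. Each pair is merged by [inv_sin_sqr_double], and doubling x gives the angle
    of level N with the same index. *)
Lemma rsum_inv_sin_sqr_double (N : nat) :
  rsum (fun k => / sin (odd_angle (2 * N) k) ^ 2) (2 * N)
  = 4 * rsum (fun k => / sin (odd_angle N k) ^ 2) N.
Proof.
  replace (2 * N)%nat with (N + N)%nat by lia.
  rewrite rsum_app,
    (rsum_rev (fun k => / sin (odd_angle (N + N) (N + k)) ^ 2)),
    <- rsum_plus, <- rsum_scal.
  apply rsum_ext. intros k Hk.
  assert (HN : 0 < INR N) by (apply lt_0_INR; lia).
  replace (odd_angle N k) with (2 * odd_angle (N + N) k)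
    by (unfold odd_angle; rewrite (plus_INR N N); field; lra).
  rewrite <- inv_sin_sqr_double by (apply odd_angle_bounds; lia).
  do 4 f_equal. unfold odd_angle.
  replace (2 * (N + (N - 1 - k)) + 1)%nat with (4 * N - (2 * k + 1))%nat by lia.
  rewrite minus_INR, (mult_INR 4), (plus_INR N N) by lia.
  change (INR 4) with (2 + 1 + 1). field. lra.
Qed.

Lemma rsum_inv_sin_sqr (n : nat) :
  rsum (fun k => / sin (odd_angle (2 ^ n) k) ^ 2) (2 ^ n) = 2 * INR (2 ^ n) ^ 2.
Proof.
  induction n as [|n IH].
  (* For N = 1 the only angle is pi/4, where 1/sin^2 is 2. *)
  - simpl. unfold odd_angle. simpl.
    replace (1 * PI / (4 * 1)) with (PI / 4) by field.
    rewrite sin_PI4. pose proof (sqrt_lt_R0 2 ltac:(lra)).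
    replace (1 / sqrt 2 * (1 / sqrt 2 * 1)) with (/ (sqrt 2 * sqrt 2)) by (field; lra).
    rewrite sqrt_sqrt by lra. field.
  - rewrite Nat.pow_succ_r', rsum_inv_sin_sqr_double, IH, (mult_INR 2).
    change (INR 2) with 2. ring.
Qed.

Definition odd_sum (N : nat) : R := rsum (fun k => / INR (2 * k + 1) ^ 2) N.

(** The bounds of [inv_sin_sqr_bounds] are summed over the N angles and multiplied by pi^2/(16 N^2).
    The N summands 1 of the upper bound become the error pi^2/(16 N). *)
Lemma odd_sum_bounds (n : nat) :
  PI ^ 2 / 8 - PI ^ 2 / 16 * / INR (2 ^ n) <= odd_sum (2 ^ n) <= PI ^ 2 / 8.
Proof.
  set (N := (2 ^ n)%nat).
  assert (HN : 0 < INR N) by (apply lt_0_INR; unfold N; apply Nat.neq_0_lt_0, Nat.pow_nonzero; lia).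
  pose proof PI_RGT_0 as HP.
  assert (E : rsum (fun k => / odd_angle N k ^ 2) N
              = 16 * INR N ^ 2 / PI ^ 2 * odd_sum N).
  { unfold odd_sum. rewrite <- rsum_scal. apply rsum_ext. intros k _.
    unfold odd_angle. field. split; [|lra]. apply not_0_INR. lia. }
  assert (L : rsum (fun k => / odd_angle N k ^ 2) N <= 2 * INR N ^ 2).
  { unfold N at 3. rewrite <- rsum_inv_sin_sqr. apply rsum_le. intros k Hk.
    apply inv_sin_sqr_bounds, odd_angle_bounds, Hk. }
  assert (U : 2 * INR N ^ 2 <= INR N + rsum (fun k => / odd_angle N k ^ 2) N).
  { unfold N at 1. rewrite <- rsum_inv_sin_sqr, <- rsum_one, <- rsum_plus.
    apply rsum_le. intros k Hk. apply inv_sin_sqr_bounds, odd_angle_bounds, Hk. }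
  rewrite E in L, U.
  assert (C : 0 < PI ^ 2 / (16 * INR N ^ 2))
    by (apply Rdiv_lt_0_compat; [|apply Rmult_lt_0_compat]; try apply pow_lt; lra).
  apply (Rmult_le_compat_l _ _ _ (Rlt_le _ _ C)) in L, U.
  replace (PI ^ 2 / (16 * INR N ^ 2) * (2 * INR N ^ 2)) with (PI ^ 2 / 8) in L, U
    by (field; lra).
  replace (PI ^ 2 / (16 * INR N ^ 2) * (16 * INR N ^ 2 / PI ^ 2 * odd_sum N))
    with (odd_sum N) in L by (field; lra).
  replace (PI ^ 2 / (16 * INR N ^ 2) * (INR N + 16 * INR N ^ 2 / PI ^ 2 * odd_sum N))
    with (PI ^ 2 / 16 * / INR N + odd_sum N) in U by (field; lra).
  lra.
Qed.

(** The terms with even denominators, 1/(2j)^2, make up a quarter of the sum up to N. *)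
Lemma rsum_inv_sqr_double (N : nat) :
  rsum (fun k => / INR (S k) ^ 2) (2 * N)
  = odd_sum N + / 4 * rsum (fun k => / INR (S k) ^ 2) N.
Proof.
  unfold odd_sum. induction N as [|N IH]; [simpl; lra|].
  replace (2 * S N)%nat with (S (S (2 * N))) by lia.
  cbn [rsum]. rewrite IH.
  replace (S (2 * N)) with (2 * N + 1)%nat by lia.
  replace (S (2 * N + 1)) with (2 * S N)%nat by lia.
  rewrite (mult_INR 2 (S N)). change (INR 2) with 2.
  field. split; apply not_0_INR; lia.
Qed.

Lemma is_lim_seq_inv_pow2 : is_lim_seq (fun n => / INR (2 ^ n)) 0.
Proof.
  apply is_lim_seq_ext with (fun n => (/ 2) ^ n).
  - intros n. rewrite pow_INR, pow_inv. reflexivity.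
  - apply is_lim_seq_geom. rewrite Rabs_pos_eq; lra.
Qed.

(** For N a power of 2, z(N) <= z(2N) <= pi^2/8 + z(N)/4 bounds the increasing partial sums by
    pi^2/6. Hence a limit l exists, and the doubling identity in the limit reads l = pi^2/8 +
    l/4. *)
Lemma Basel : is_series (fun k => / INR (S k) ^ 2) (PI ^ 2 / 6).
Proof.
  set (z := rsum (fun k => / INR (S k) ^ 2)).
  assert (Hpos : forall k, 0 <= / INR (S k) ^ 2).
  { intros k. left. apply Rinv_0_lt_compat, pow_lt, lt_0_INR. lia. }
  assert (Hz : forall n, z n <= PI ^ 2 / 6).
  { intros n. apply Rle_trans with (z (2 ^ n)%nat).
    - apply rsum_incr; [exact Hpos|]. apply Nat.lt_le_incl, Nat.pow_gt_lin_r. lia.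
    - pose proof (rsum_inv_sqr_double (2 ^ n)) as D.
      pose proof (odd_sum_bounds n) as B.
      assert (M : z (2 ^ n)%nat <= z (2 * 2 ^ n)%nat)
        by (apply rsum_incr; [exact Hpos|lia]).
      unfold z in *. lra. }
  destruct (ex_finite_lim_seq_incr z (PI ^ 2 / 6)) as [l Hl]; [|exact Hz|].
  { intros n. apply rsum_incr; [exact Hpos|lia]. }
  assert (Sub : forall phi, (forall n, (n <= phi n)%nat) ->
    is_lim_seq (fun n => z (phi n)) l).
  { intros phi Hphi. apply (is_lim_seq_subseq z l phi); [|exact Hl].
    intros P [N HN]. exists N. intros n Hn. apply HN. specialize (Hphi n). lia. }
  assert (Pow : forall n, (n <= 2 ^ n)%nat)
    by (intros n; apply Nat.lt_le_incl, Nat.pow_gt_lin_r; lia).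
  assert (O : is_lim_seq (fun n => odd_sum (2 ^ n)) (PI ^ 2 / 8)).
  { apply is_lim_seq_le_le with
      (fun n => PI ^ 2 / 8 - PI ^ 2 / 16 * / INR (2 ^ n)) (fun _ => PI ^ 2 / 8).
    - apply odd_sum_bounds.
    - replace (Finite (PI ^ 2 / 8)) with (Finite (PI ^ 2 / 8 - PI ^ 2 / 16 * 0))
        by (f_equal; ring).
      apply is_lim_seq_minus'; [apply is_lim_seq_const|].
      apply (is_lim_seq_scal_l _ _ 0), is_lim_seq_inv_pow2.
    - apply is_lim_seq_const. }
  assert (A : is_lim_seq (fun n => z (2 * 2 ^ n)%nat) (PI ^ 2 / 8 + / 4 * l)).
  { apply is_lim_seq_ext with (fun n => odd_sum (2 ^ n) + / 4 * z (2 ^ n)%nat).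
    - intros n. symmetry. apply rsum_inv_sqr_double.
    - apply is_lim_seq_plus'; [exact O|].
      apply (is_lim_seq_scal_l _ _ l), Sub, Pow. }
  apply is_lim_seq_unique in A.
  rewrite (is_lim_seq_unique _ l) in A
    by (apply (Sub (fun n => (2 * 2 ^ n)%nat)); intros n; specialize (Pow n); lia).
  injection A as A.
  replace (PI ^ 2 / 6) with l by lra.
  change (is_lim_seq (sum_n (fun k => / INR (S k) ^ 2)) l).
  (* [sum_n] includes its upper index while [rsum] excludes it, hence the shift. *)
  apply is_lim_seq_ext with (fun n => z (S n)).
  - intros n. unfold z. induction n as [|n IH].
    + rewrite sum_O. simpl. lra.
    + rewrite sum_Sn, <- IH. reflexivity.
  - apply Sub. intros n. lia.
Qed.

(** Abel's theorem concerns the boundary of the disc of convergence, so the exact radius is wanted.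
    The ratio of consecutive coefficients is ((n+1)/(n+2))^2, that is [(1 - small n) ^ 2]. *)
Lemma CV_radius_incr_inv_sqr :
  CV_radius (PS_incr_1 (fun k => / INR (S k) ^ 2)) = 1.
Proof.
  rewrite CV_radius_incr_1.
  replace (Finite 1) with (Finite (/ 1)) by (f_equal; field).
  apply CV_radius_finite_DAlembert; [|lra|].
  - intros n. apply Rinv_neq_0_compat, pow_nonzero, not_0_INR. lia.
  - apply is_lim_seq_ext with (fun n => (1 - small n) ^ 2).
    + intros n. unfold small. pose proof (pos_INR n).
      rewrite !S_INR, Rabs_pos_eq.
      * field. lra.
      * left. apply Rdiv_lt_0_compat; apply Rinv_0_lt_compat, pow_lt; lra.
    + replace (Finite 1) with (Finite (1 ^ 2)) by (f_equal; ring).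
      apply (is_lim_seq_continuous (fun t => t ^ 2)); [|apply is_lim_seq_one_minus_small].
      apply derivable_continuous_pt, derivable_pt_pow.
Qed.

Lemma Li2_1 : Li2 1 = PI ^ 2 / 6.
Proof.
  rewrite <- (is_series_unique _ _ Basel). apply Series_ext. intros n.
  rewrite pow1. apply Rmult_1_l.
Qed.

Lemma is_lim_seq_Li2_1 : is_lim_seq (fun n => Li2 (1 - small n)) (PI ^ 2 / 6).
Proof.
  rewrite <- Li2_1, Li2_PSeries.
  apply is_lim_seq_ext with (1 := fun n => eq_sym (Li2_PSeries (1 - small n))).
  set (a := PS_incr_1 _).
  assert (CV : CV_radius a = 1) by apply CV_radius_incr_inv_sqr.
  pose proof (Abel a) as H. rewrite CV in H. simpl in H.
  apply (filterlim_comp _ _ _ (fun n => 1 - small n) (PSeries a) _ (at_left 1)).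
  - intros P HP. destruct HP as [e He].
    destruct (proj2 (is_lim_seq_spec _ _) is_lim_seq_one_minus_small e) as [N HN].
    exists N. intros n Hn. apply He; [apply HN, Hn|].
    pose proof (small_bounds n). lra.
  - apply H; [lra|exact I|].
    exists (PI ^ 2 / 6). apply is_pseries_R.
    apply is_series_ext with (a := fun n => a n).
    { intros n. rewrite pow1. symmetry. apply Rmult_1_r. }
    (* The coefficient at index 0 is 0; without it the series at 1 is the Basel sum. *)
    apply is_series_decr_1. replace (plus _ _) with (PI ^ 2 / 6); [apply Basel|].
    change (PI ^ 2 / 6 = PI ^ 2 / 6 + - 0). ring.
Qed.

Lemma rogersL_reflection (x : R) : 0 < x < 1 ->
  rogersL x + rogersL (1 - x) = PI ^ 2 / 6.
Proof.
  apply (derive_zero_eq_limit (fun t => rogersL t + rogersL (1 - t))).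
  - intros t Ht.
    pose proof (is_derive_rogersL t Ht) as D0.
    assert (D1 : is_derive (fun t => 1 - t) t (-1)) by (auto_derive; [trivial|ring]).
    apply is_derive_rogersL_comp in D1; [|lra].
    pose proof (is_derive_plus _ _ _ _ _ D0 D1) as D.
    match type of D with is_derive _ _ ?d => replace 0 with d; [exact D|] end.
    unfold plus; simpl. replace (1 - (1 - t)) with t by ring. field. lra.
  (* The product of logarithms is symmetric under t -> 1 - t, so its limit 0 at 0 serves at 1 as
     well. *)
  - apply is_lim_seq_ext with (fun n => rogersL (small n)
      + (Li2 (1 - small n) + 1 / 2 * (ln (small n) * ln (1 - small n)))).
    + intros n. unfold rogersL at 3. replace (1 - (1 - small n)) with (small n) by ring.
      ring.
    + replace (Finite (PI ^ 2 / 6)) with (Finite (0 + (PI ^ 2 / 6 + 1 / 2 * 0)))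
        by (f_equal; ring).
      apply is_lim_seq_plus'; [|apply is_lim_seq_plus'].
      * apply is_lim_seq_rogersL_0; [apply small_bounds|apply small_lim].
      * apply is_lim_seq_Li2_1.
      * apply (is_lim_seq_scal_l _ _ 0), is_lim_seq_ln_mul_ln;
          [apply small_bounds|apply small_lim].
Qed.

(* The remaining cyclic equations [z3 * z5 = 1 - z4] and [z4 * z1 = 1 - z5]
   follow from the three assumed. *)
Lemma rogersL_pentagon (z1 z2 z3 z4 z5 : R) :
  0 < z1 < 1 -> 0 < z3 < 1 ->
  z1 * z3 = 1 - z2 -> z2 * z4 = 1 - z3 -> z5 * z2 = 1 - z1 ->
  rogersL z1 + rogersL z2 + rogersL z3 + rogersL z4 + rogersL z5 = PI ^ 2 / 2.
Proof.
  intros H1 H3 E2 E3 E1.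
  pose proof (mult_unit z1 z3 H1 H3) as H2.
  pose proof (five_term_unit z1 z3 H1 H3) as H5.
  pose proof (five_term_unit z3 z1 H3 H1) as H4. rewrite (Rmult_comm z3 z1) in H4.
  pose proof (rogersL_five_term z1 z3 H1 H3) as F.
  (* With x = z1 and y = z3, the numbers z2, z4, z5 are the complements of the three arguments on
     the right of the five-term relation. Three reflections then give the constant 3 * PI^2/6. *)
  replace z2 with (1 - z1 * z3) by lra.
  replace z4 with (1 - z3 * (1 - z1) / (1 - z1 * z3)).
  2:{ rewrite E2. apply Rmult_eq_reg_l with z2; [|lra]. rewrite E3.
      replace z2 with (1 - z1 * z3) by lra. field. lra. }
  replace z5 with (1 - z1 * (1 - z3) / (1 - z1 * z3)).
  2:{ rewrite E2. apply Rmult_eq_reg_r with z2; [|lra]. rewrite E1.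
      replace z2 with (1 - z1 * z3) by lra. field. lra. }
  pose proof (rogersL_reflection _ H2).
  pose proof (rogersL_reflection _ H4).
  pose proof (rogersL_reflection _ H5).
  lra.
Qed.

(** * The root of the cubic in (0,1) *)

Lemma cubic_factor (r x : R) : is_rho r ->
  r * (x ^ 3 - 5 * x ^ 2 + 2 * x + 1) = (r - x) * (1 + r * x * (5 - x - r)).
Proof.
  intros [_ E].
  (* Division of the cubic by x - r leaves a quotient with constant term r^2 - 5r + 2 = -1/r, whose
     denominator the factor r clears. *)
  replace (r * (x ^ 3 - 5 * x ^ 2 + 2 * x + 1))
    with ((r - x) * (1 + r * x * (5 - x - r))
          + x * (r ^ 3 - 5 * r ^ 2 + 2 * r + 1)) by ring.
  rewrite E. ring.
Qed.

Lemma cubic_cofactor_pos (r x : R) : is_rho r -> 0 < x < 1 ->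
  0 < 1 + r * x * (5 - x - r).
Proof.
  intros [Hr _] Hx.
  assert (0 < r * x * (5 - x - r)) by (repeat apply Rmult_lt_0_compat; lra).
  lra.
Qed.

Lemma is_rho_unique (r s : R) : is_rho r -> is_rho s -> r = s.
Proof.
  intros Hr Hs. pose proof (cubic_factor r s Hr) as F.
  pose proof (cubic_cofactor_pos r s Hr (proj1 Hs)) as C.
  rewrite (proj2 Hs), Rmult_0_r in F.
  symmetry in F. apply Rmult_integral in F. lra.
Qed.

(** The cofactor is positive, so on (0,1) the cubic has the sign of r - x, and its value at a
    rational number tells on which side the root lies. *)
Lemma is_rho_lower (r x : R) :
  is_rho r -> 0 < x < 1 -> 0 < x ^ 3 - 5 * x ^ 2 + 2 * x + 1 -> x < r.
Proof.
  intros Hr Hx Hp. pose proof (cubic_factor r x Hr) as F.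
  pose proof (cubic_cofactor_pos r x Hr Hx) as C.
  apply (Rmult_lt_0_compat r) in Hp; [|apply Hr]. rewrite F in Hp.
  apply Rnot_le_lt. intros L. nra.
Qed.

Lemma is_rho_upper (r x : R) :
  is_rho r -> 0 < x < 1 -> x ^ 3 - 5 * x ^ 2 + 2 * x + 1 < 0 -> r < x.
Proof.
  intros Hr Hx Hp. pose proof (cubic_factor r x Hr) as F.
  pose proof (cubic_cofactor_pos r x Hr Hx) as C.
  apply (Rmult_lt_compat_l r) in Hp; [|apply Hr]. rewrite F in Hp.
  apply Rnot_le_lt. intros L. nra.
Qed.

Lemma is_rho_exists : exists r, is_rho r.
Proof.
  (* The cubic is positive at 1/2 and negative at 9/10; [IVT] expects the opposite signs. *)
  destruct (IVT (fun x => - (x ^ 3 - 5 * x ^ 2 + 2 * x + 1)) (1 / 2) (9 / 10))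
    as [r [Hr E]]; [|lra|lra|lra|].
  - intros x. reg.
  - exists r. split; lra.
Qed.

(** Coefficients in the thousands nearly cancel in some elements below, which lie within 10^(-3) of
    0 or 1. Placing these in (0,1) takes a root known to many digits. *)
Lemma is_rho_bounds (r : R) : is_rho r ->
  77812383773680 / 10 ^ 14 < r < 77812383773681 / 10 ^ 14.
Proof.
  intros Hr. split; [apply is_rho_lower|apply is_rho_upper]; trivial; lra.
Qed.

(** * The dilogarithm ladder in the cubic field of conductor 19 *)

(** Elements of Q(rho) on the basis 1, rho, rho^2. Each is always given by the same four integers,
    so that [lra] recognises equal dilogarithm values as one unknown. *)
Definition elt (r : R) (a b c d : Z) : R :=
  (IZR a + IZR b * r + IZR c * r ^ 2) / IZR d.

(** A product of two elements has degree at most 4 in r, so with r^3 and r^4 reduced by [E3] and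
    [E4] the product equations are linear in r and r^2. The inequalities follow from [B] and
    [B2]. *)
Ltac pentagon a b c d f :=
  assert (rogersL a + rogersL b + rogersL c + rogersL d + rogersL f = PI ^ 2 / 2)
    by (apply rogersL_pentagon; unfold elt; lra).

Ltac reflection a b :=
  assert (rogersL a + rogersL b = PI ^ 2 / 6)
    by (replace b with (1 - a) by (unfold elt; lra);
        apply rogersL_reflection; unfold elt; lra).

(* The five-cycles come from a computer search among the units away from the
   primes above 7 and 19.  In the order listed they enter the final linear
   combination with coefficients
   1, 1, 1, -1, 2, 2, 2, -2, 2, 4, -4, 4, 2, -2, 2, 2, -4, 4. *)
Lemma rogersL_ladder (r : R) : is_rho r ->
  31 * rogersL (elt r 0 1 0 1) + rogersL (elt r 1646 (-2479) 469 1) = 4 * PI ^ 2.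
Proof.
  intros Hr. pose proof (is_rho_bounds r Hr) as B. destruct Hr as [_ Hr].
  assert (B2 : (77812383773680 / 10 ^ 14) ^ 2 < r ^ 2 < (77812383773681 / 10 ^ 14) ^ 2)
    by (split; nra).
  assert (E3 : r ^ 3 = 5 * r ^ 2 - 2 * r - 1) by lra.
  assert (E4 : r ^ 4 = 23 * r ^ 2 - 11 * r - 5).
  { replace (r ^ 4) with (r * r ^ 3) by ring. rewrite E3.
    replace (r * (5 * r ^ 2 - 2 * r - 1)) with (5 * r ^ 3 - 2 * r ^ 2 - r) by ring.
    lra. }
  clear Hr.
  pentagon (elt r (-63) 95 (-18) 1) (elt r 2 7 (-1) 7) (elt r 2 7 (-1) 7)
    (elt r (-63) 95 (-18) 1) (elt r (-5768) 8694 (-1645) 1).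
  pentagon (elt r 1646 (-2479) 469 1) (elt r 5769 (-8694) 1645 1) (elt r 21 56 (-105) 1)
    (elt r (-104) (-231) 469 1) (elt r 0 1 0 1).
  pentagon (elt r (-1) (-2) 5 1) (elt r 123 (-45) 4 133) (elt r 123 (-45) 4 133)
    (elt r (-1) (-2) 5 1) (elt r 105 231 (-469) 1).
  pentagon (elt r 2 (-1) (-2) 1) (elt r 72 96 (-25) 133) (elt r 72 96 (-25) 133)
    (elt r 2 (-1) (-2) 1) (elt r 21 56 (-105) 1).
  pentagon (elt r 17 (-18) 3 7) (elt r 64 (-95) 18 1) (elt r (-138) 208 (-39) 7)
    (elt r 72 96 (-25) 133) (elt r 10 45 (-4) 133).
  pentagon (elt r 145 (-208) 39 7) (elt r (-6) 13 (-2) 7) (elt r 0 0 1 1)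
    (elt r 0 2 (-1) 1) (elt r 14 (-21) 4 1).
  pentagon (elt r 18 39 (-10) 49) (elt r (-10) 18 (-3) 7) (elt r 18 (-26) 5 1)
    (elt r 8 (-11) 2 1) (elt r (-1) 6 (-1) 7).
  pentagon (elt r 2 7 (-1) 7) (elt r 1 (-1) 0 1) (elt r 18 (-26) 5 1)
    (elt r (-13) 21 (-4) 1) (elt r 4 (-5) 1 7).
  pentagon (elt r 4 (-5) 1 1) (elt r 13 (-13) 2 7) (elt r 0 6 (-1) 7)
    (elt r 29 11 (-4) 49) (elt r (-8) 17 (-3) 7).
  pentagon (elt r (-3) 5 (-1) 1) (elt r (-13) 21 (-4) 1) (elt r (-3) 5 (-1) 1)
    (elt r 0 1 0 1) (elt r 0 1 0 1).
  pentagon (elt r 12 (-8) 1 7) (elt r (-8) 17 (-3) 7) (elt r 8 (-6) 1 7)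
    (elt r 3 5 (-1) 7) (elt r 3 (-3) 1 7).
  pentagon (elt r 4 (-5) 1 1) (elt r (-7) 11 (-2) 1) (elt r 12 (-8) 1 7)
    (elt r 1 1 0 7) (elt r 4 3 (-1) 7).
  pentagon (elt r 2 2 (-5) 1) (elt r 0 1 0 1) (elt r 7 (-6) 1 7)
    (elt r 6 (-1) 0 7) (elt r 0 0 1 1).
  pentagon (elt r (-1) 1 2 1) (elt r 1 (-2) 1 1) (elt r 5 3 (-1) 7)
    (elt r 3 4 (-1) 7) (elt r 1 (-1) 0 1).
  pentagon (elt r 31 (-39) 10 49) (elt r 3 5 (-1) 7) (elt r 6 (-1) 0 7)
    (elt r 20 (-11) 4 49) (elt r 5 3 (-1) 7).
  pentagon (elt r 4 (-5) 1 1) (elt r 8 (-11) 2 1) (elt r (-8) 17 (-3) 7)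
    (elt r 3 4 (-1) 7) (elt r (-1) 6 (-1) 7).
  pentagon (elt r 1 (-1) 0 1) (elt r 4 3 (-1) 7) (elt r 4 3 (-1) 7)
    (elt r 1 (-1) 0 1) (elt r 0 2 (-1) 1).
  pentagon (elt r 0 1 0 1) (elt r 1 0 (-1) 1) (elt r 0 1 0 1)
    (elt r 8 (-6) 1 7) (elt r 8 (-6) 1 7).
  (* Reflections identify x with 1 - x up to sign and constants. In the stated combination of
     five-cycles only the values at rho and sigma then survive. *)
  reflection (elt r (-5768) 8694 (-1645) 1) (elt r 5769 (-8694) 1645 1).
  reflection (elt r (-1) 1 2 1) (elt r 2 (-1) (-2) 1).
  reflection (elt r 64 (-95) 18 1) (elt r (-63) 95 (-18) 1).
  reflection (elt r 145 (-208) 39 7) (elt r (-138) 208 (-39) 7).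
  reflection (elt r 0 2 (-1) 1) (elt r 1 (-2) 1 1).
  reflection (elt r (-13) 21 (-4) 1) (elt r 14 (-21) 4 1).
  reflection (elt r 3 5 (-1) 7) (elt r 4 (-5) 1 7).
  reflection (elt r 18 39 (-10) 49) (elt r 31 (-39) 10 49).
  reflection (elt r 4 3 (-1) 7) (elt r 3 (-3) 1 7).
  reflection (elt r 0 1 0 1) (elt r 1 (-1) 0 1).
  reflection (elt r 105 231 (-469) 1) (elt r (-104) (-231) 469 1).
  reflection (elt r 6 (-1) 0 7) (elt r 1 1 0 7).
  reflection (elt r 29 11 (-4) 49) (elt r 20 (-11) 4 49).
  reflection (elt r 4 (-5) 1 1) (elt r (-3) 5 (-1) 1).
  reflection (elt r 17 (-18) 3 7) (elt r (-10) 18 (-3) 7).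
  reflection (elt r 123 (-45) 4 133) (elt r 10 45 (-4) 133).
  reflection (elt r 8 (-11) 2 1) (elt r (-7) 11 (-2) 1).
  reflection (elt r 0 0 1 1) (elt r 1 0 (-1) 1).
  reflection (elt r 13 (-13) 2 7) (elt r (-6) 13 (-2) 7).
  reflection (elt r 0 6 (-1) 7) (elt r 7 (-6) 1 7).
  reflection (elt r 8 (-6) 1 7) (elt r (-1) 6 (-1) 7).
  reflection (elt r 2 2 (-5) 1) (elt r (-1) (-2) 5 1).
  clear B B2 E3 E4.
  lra.
Qed.

(** * Sigma as a polynomial in rho, and the conclusion *)

Lemma rho_pow_6 (r : R) : is_rho r -> r ^ 6 = 469 * r ^ 2 - 231 * r - 104.
Proof.
  intros [_ E].
  (* Quotient and remainder of X^6 by the cubic. *)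
  replace (r ^ 6) with ((r ^ 3 - 5 * r ^ 2 + 2 * r + 1)
    * (r ^ 3 + 5 * r ^ 2 + 23 * r + 104) + 469 * r ^ 2 - 231 * r - 104) by ring.
  rewrite E. ring.
Qed.

Lemma sigma_of_elt (r : R) : is_rho r -> sigma_of r = elt r 1646 (-2479) 469 1.
Proof.
  intros Hr. pose proof (rho_pow_6 r Hr) as E6. destruct Hr as [Hr E].
  unfold sigma_of, elt.
  assert (P6 : 0 < r ^ 6) by (apply pow_lt; lra).
  apply Rmult_eq_reg_r with (r ^ 6); [|lra].
  unfold Rdiv. rewrite Rmult_assoc, Rinv_l by lra. rewrite E6.
  (* The linear factor is the quotient by the cubic of (469 r^2 - 2479 r + 1646)(469 r^2 - 231 r -
     104) - (1 - r), which it divides exactly. *)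
  assert (K : (219961 * r - 171185) * (r ^ 3 - 5 * r ^ 2 + 2 * r + 1) = 0)
    by (rewrite E; ring).
  lra.
Qed.

Theorem propositionA1 :
  (exists! rho : R, is_rho rho) /\
  (forall rho : R, is_rho rho ->
     0 < sigma_of rho < 1 /\
     31 * rogersL rho + rogersL (sigma_of rho) = 4 * PI ^ 2).
Proof.
  split.
  - destruct is_rho_exists as [r Hr]. exists r. split; [exact Hr|].
    intros s Hs. apply is_rho_unique; assumption.
  - intros r Hr. split.
    + rewrite sigma_of_elt by exact Hr.
      pose proof (is_rho_bounds r Hr) as B. unfold elt.
      split; nra.
    + rewrite sigma_of_elt, <- (rogersL_ladder r Hr) by exact Hr.
      replace (elt r 0 1 0 1) with r by (unfold elt; field). reflexivity.
Qed.
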